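(* Let $\mathcal S$ be a set (measurable space), $\Psi$ any set of functions $\mathcal S\to\mathbb R$, and $\mathcal D$ any set of probability distributions on $\mathcal S$. For every $\varepsilon>0$, $\mathrm{DE}_1(\Psi,\mathcal D,\varepsilon)\le\mathrm{DE}_2(\Psi,\mathcal D,\varepsilon)$.
   Context: $\ell_p$-distributional eluder dimension. For $\varepsilon'>0$, a distribution $\nu\in\mathcal D$ is $(\varepsilon',\ell_p)$-independent of a finite sequence $d^{(1)},\dots,d^{(n)}$ in $\mathcal D$ if there exists $\psi\in\Psi$ with $|\mathbb E_\nu\psi|>\varepsilon'$ and $\sum_{i=1}^n|\mathbb E_{d^{(i)}}\psi|^p\le(\varepsilon')^p$. For $\varepsilon>0$, $\mathrm{DE}_p(\Psi,\mathcal D,\varepsilon)$ is the length $L$ of the longest sequence $d^{(1)},\dots,d^{(L)}$ in $\mathcal D$ for which there exists $\varepsilon'\ge\varepsilon$ such that for all $t\in[L]$, $d^{(t)}$ is $(\varepsilon',\ell_p)$-independent of $d^{(1)},\dots,d^{(t-1)}$. *)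

(* Defs.v *)
From HB Require Import structures.
From mathcomp Require Import all_boot all_order all_algebra.
From mathcomp Require Import all_classical all_reals all_analysis.

Set Implicit Arguments.
Unset Strict Implicit.
Unset Printing Implicit Defensive.
Import Order.TTheory GRing.Theory Num.Theory.
Import numFieldNormedType.Exports.

Local Open Scope classical_set_scope.
Local Open Scope ring_scope.

(* ['E_nu[psi]] is extended-real valued and total. It is the usual expectation
   as soon as [psi] is [nu]-integrable; no integrability is imposed on [psi]. *)
Definition lp_independent (d : measure_display) (S : measurableType d)
    (R : realType) (p : R) (Psi : set (S -> R)) (eps : R)
    (nu : probability S R) (ds : seq (probability S R)) : Prop :=
  exists psi : S -> R,
    [/\ Psi psi,
        (eps%:E < `| 'E_nu[psi] |)%E
      & (\sum_(mu <- ds) `| 'E_mu[psi] | `^ p <= (eps `^ p)%:E)%E].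

(* [tnth ds t] is the (t+1)-st term, and [take t ds] the terms before it. *)
Definition eluder_sequence (d : measure_display) (S : measurableType d)
    (R : realType) (p : R) (Psi : set (S -> R)) (D : set (probability S R))
    (eps : R) (L : nat) (ds : L.-tuple (probability S R)) : Prop :=
  (forall t : 'I_L, D (tnth ds t)) /\
  exists eps' : R, eps <= eps' /\
    forall t : 'I_L, lp_independent p Psi eps' (tnth ds t) (take t ds).

(* The value is [+oo] exactly when there are arbitrarily long sequences. *)
Definition eluder_dim (d : measure_display) (S : measurableType d)
    (R : realType) (p : R) (Psi : set (S -> R)) (D : set (probability S R))
    (eps : R) : \bar R :=
  ereal_sup [set (L%:R : R)%:E | L in
    [set L : nat | exists ds : L.-tuple (probability S R),
                     eluder_sequence p Psi D eps ds]].

(* Main.v *)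
(* With the same witnesses and the same scale [eps'], l_1-independence implies
   l_2-independence: nonnegative terms satisfy [\sum x_i^2 <= (\sum x_i)^2], so
   an l_1 bound by [eps'] gives an l_2 bound by [eps'^2]. *)
Require Import Defs.
From mathcomp Require Import all_boot all_order all_algebra.
From mathcomp Require Import all_classical all_reals all_analysis.

Import Order.TTheory GRing.Theory Num.Theory.

Local Open Scope classical_set_scope.
Local Open Scope ring_scope.

(** Induction on [s]: with tail sum [T], [(a + T)(a + T) = a(a + T) + T(a + T)] dominates
    [a * a + T * T]. Nonnegativity makes distributivity safe even when terms are [+oo]. *)
Lemma sume_sqr_le (R : realType) (I : Type) (s : seq I) (f : I -> \bar R) :
  (forall i, 0 <= f i)%E ->
  (\sum_(i <- s) f i * f i <= (\sum_(i <- s) f i) * (\sum_(i <- s) f i))%E.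
Proof.
move=> f0; elim: s => [|i s IHs]; first by rewrite !big_nil mule0.
have S0 : (0 <= \sum_(j <- s) f j)%E by apply: sume_ge0 => j _.
rewrite !big_cons ge0_muleDl //; apply: leeD.
  by apply: lee_wpmul2l => //; apply: leeDl.
apply: (le_trans IHs); apply: lee_wpmul2l => //; exact: leeDr.
Qed.

Lemma poweR2 (R : realType) (x : \bar R) : (0 <= x -> x `^ 2 = x * x)%E.
Proof.
(* The value [+oo] must be covered, since expectations may be infinite. *)
case: x => [r| |] // r0; last by rewrite poweRyr ?mulyy // pnatr_eq0.
by rewrite poweR_EFin powR_mulrn // -EFinM expr2.
Qed.

Lemma lp_independent_12 (d : measure_display) (S : measurableType d)
    (R : realType) (Psi : set (S -> R)) (e : R) (nu : probability S R)
    (ds : seq (probability S R)) :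
  0 <= e -> lp_independent 1 Psi e nu ds -> lp_independent 2 Psi e nu ds.
Proof.
move=> e0 [psi [Ppsi lt_e le_e]]; exists psi; split=> //.
under eq_bigr do rewrite poweR2 //.
apply: (le_trans (sume_sqr_le _ _ _ _ _)) => //.
rewrite powR_mulrn // expr2 EFinM.
have {}le_e : (\sum_(mu <- ds) `| 'E_mu[psi] | <= e%:E)%E.
  by move: le_e; rewrite powRr1 //; under eq_bigr do rewrite poweRe1 //.
by apply: lee_pmul => //; apply: sume_ge0 => mu _.
Qed.

Theorem lemma5p4 (R : realType) (d : measure_display) (S : measurableType d)
    (Psi : set (S -> R)) (D : set (probability S R)) (eps : R)
    (heps : 0 < eps) :
  (eluder_dim 1 Psi D eps <= eluder_dim 2 Psi D eps)%E.
Proof.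
(* The suprema compare by inclusion of the sets of lengths; [0 < eps <= e] gives the sign of the
   scale. *)
apply: le_ereal_sup => _ [L [ds [Dds [e [le_e indep]]]] <-]; exists L => //.
exists ds; split=> //; exists e; split=> // t.
by apply: lp_independent_12 (indep t); apply: le_trans le_e; apply: ltW.
Qed.
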